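(* Let $f:\mathbb{R}^n\to\mathbb{R}$ be differentiable, $\mu$-strongly convex and $L$-smooth. Let $\alpha_k\ge1$ and $\gamma_k\in[\gamma_-,\gamma_+]$ with $0<\gamma_-\le\gamma_+<\infty$ for all $k$, and set $\tau_k=\frac1{\alpha_k}+\frac\mu{\gamma_k}$, $\lambda_k=\frac{\alpha_k}{\gamma_k(1+\tau_k)}$. Let $c_k,\xi_k$ be random vectors in $\mathbb{R}^n$, let $x_{k+1}=\mathrm{prox}_{\lambda_kf}(c_k+\xi_k)$ be the exact resolvent point, and define the fixed-point residual $$g_k(u):=u-(c_k+\xi_k)+\lambda_k\nabla f(u).$$ Then for any $u\in\mathbb{R}^n$, $$\|u-x_{k+1}\|\le\frac{\|g_k(u)\|}{1+\lambda_k\mu}.$$ Consequently, if $\tilde x_{k+1}$ is a random point with $\mathbb{E}\|g_k(\tilde x_{k+1})\|^2\le\delta_k^2$, then $$\mathbb{E}\|\tilde x_{k+1}-x_{k+1}\|^2\le\frac{\delta_k^2}{(1+\lambda_k\mu)^2}.$$ Moreover $(1+\lambda_k\mu)^{-2}=O(\alpha_k^{-2})$ uniformly in $k$, and therefore any bounded residual tolerance $\delta_k=O(1)$ yields $\mathbb{E}\|\tilde x_{k+1}-x_{k+1}\|^2=O(\alpha_k^{-2})$.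
   Context: Norms are Euclidean. $\mu$-strong convexity and $L$-smoothness, $0<\mu\le L<\infty$: for all $x,y$, $\frac\mu2\|x-y\|^2\le f(x)-f(y)-\langle\nabla f(y),x-y\rangle\le\frac L2\|x-y\|^2$. For $\lambda>0$, $\mathrm{prox}_{\lambda f}(z)=\arg\min_x\{\lambda f(x)+\frac12\|x-z\|^2\}$, equivalently the unique $x$ with $x+\lambda\nabla f(x)=z$. The $O(\cdot)$ constants do not depend on $k$ or on the stepsizes $\alpha_k$. *)

(* Defs.v *)
From HB Require Import structures.
From mathcomp Require Import all_boot all_order all_algebra.
From mathcomp Require Import all_classical all_reals all_analysis.

Set Implicit Arguments.
Unset Strict Implicit.
Unset Printing Implicit Defensive.

Import Order.TTheory GRing.Theory Num.Theory.
Import numFieldNormedType.Exports.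

Local Open Scope classical_set_scope.
Local Open Scope ring_scope.

Definition dotp (R : realType) (n : nat) (u v : 'rV[R]_n) : R :=
  \sum_(i < n) u 0 i * v 0 i.

(* The canonical norm `|u| on 'rV[R]_n is the sup norm, hence this one.  It
   induces the same topology, so that [differentiable] is unaffected. *)
Definition enorm (R : realType) (n : nat) (u : 'rV[R]_n) : R :=
  Num.sqrt (dotp u u).

Definition grad (R : realType) (n : nat) (f : 'rV[R]_n -> R) (x : 'rV[R]_n) :
    'rV[R]_n :=
  \row_(i < n) 'D_(delta_mx 0 i) f x.

(* First-order forms, for differentiable [f]. *)
Definition strongly_convex (R : realType) (n : nat) (mu : R)
    (f : 'rV[R]_n -> R) : Prop :=
  forall x y, mu / 2 * enorm (x - y) ^+ 2 <= f x - f y - dotp (grad f y) (x - y).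

Definition smooth (R : realType) (n : nat) (L : R) (f : 'rV[R]_n -> R) : Prop :=
  forall x y, f x - f y - dotp (grad f y) (x - y) <= L / 2 * enorm (x - y) ^+ 2.

(* [xget 0 A] is an element of [A] when there is one, and 0 otherwise. *)
Definition prox (R : realType) (n : nat) (lam : R) (f : 'rV[R]_n -> R)
    (z : 'rV[R]_n) : 'rV[R]_n :=
  xget 0 [set x | forall y,
    lam * f x + 2^-1 * enorm (x - z) ^+ 2 <= lam * f y + 2^-1 * enorm (y - z) ^+ 2].

Definition random_vector (d : measure_display) (T : measurableType d)
    (R : realType) (n : nat) (X : T -> 'rV[R]_n) : Prop :=
  forall i : 'I_n, measurable_fun [set: T] (fun w => X w 0 i).

Definition tau (R : realType) (mu alpha gamma : R) : R :=
  1 / alpha + mu / gamma.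

Definition lambda (R : realType) (mu alpha gamma : R) : R :=
  alpha / (gamma * (1 + tau mu alpha gamma)).

(* g(u) = u - z + lam * grad f(u); the residual g_k has z = c_k + xi_k and
   lam = lambda_k. *)
Definition residual (R : realType) (n : nat) (f : 'rV[R]_n -> R) (lam : R)
    (z u : 'rV[R]_n) : 'rV[R]_n :=
  u - z + lam *: grad f u.

Definition admissible_steps (R : realType) (gamma_lo gamma_hi : R)
    (alpha gamma : nat -> R) : Prop :=
  forall k, 1 <= alpha k /\ gamma_lo <= gamma k <= gamma_hi.

(* [x 0] is left unconstrained. *)
Definition exact_resolvent (T : Type) (R : realType) (n : nat)
    (f : 'rV[R]_n -> R) (lam : nat -> R) (c xi x : nat -> T -> 'rV[R]_n) : Prop :=
  forall k w, x k.+1 w = prox (lam k) f (c k w + xi k w).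

(* Main.v *)
Require Import Defs.
From HB Require Import structures.
From mathcomp Require Import all_boot all_order all_algebra.
From mathcomp Require Import all_classical all_reals all_analysis.
From mathcomp Require Import ring lra.

Set Implicit Arguments.
Unset Strict Implicit.
Unset Printing Implicit Defensive.

Import Order.TTheory GRing.Theory Num.Theory.
Import numFieldNormedType.Exports.

Local Open Scope classical_set_scope.
Local Open Scope ring_scope.

(** The residual [residual f lam z] is a strongly monotone map, with modulus
    [1 + lam * mu]: the identity contributes 1 and, by strong convexity, the
    gradient contributes [lam * mu].  It vanishes at the exact resolvent point
    [prox lam f z].  Pairing its value at [u] with [u - prox lam f z] therefore
    bounds the distance from [u] to that point by the norm of the residual
    divided by [1 + lam * mu] ([error_le_residual]).

    [prox] is defined as a minimizer, so two facts are needed first.  A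
    minimizer exists ([prox_exists]), because sublevel sets of the proximal
    objective are bounded and closed balls are compact.  The residual is zero
    there ([residual_prox]): were it nonzero, the descent estimate that
    L-smoothness gives would make the objective strictly smaller at a point
    displaced along the negative residual.

    The mean-square bound integrates the pointwise one ([expectation_sqr_le]).
    The integral of any nonnegative function is the supremum over the simple
    functions below it, and comparing these suprema directly replaces an
    argument that the proximal point and the gradient depend measurably on the
    sample ([ge0_integral_scale_le]).

    Finally [lambda mu alpha gamma] grows at least linearly in [alpha], because
    its denominator [gamma + gamma / alpha + mu] is at most [2 * gamma + mu]
    when [1 <= alpha] ([factor_inv_sqr_le]); this gives the constant
    [((2 * gamma_hi + mu) / mu) ^+ 2] in the rate. *)

(** * The Euclidean inner product *)

Section InnerProduct.
Variables (R : realType) (n : nat).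
Implicit Types u v w : 'rV[R]_n.

Lemma dotpC u v : dotp u v = dotp v u.
Proof. by apply: eq_bigr => i _; rewrite mulrC. Qed.

Lemma dotpDl u v w : dotp (u + v) w = dotp u w + dotp v w.
Proof. by rewrite -big_split; apply: eq_bigr => i _; rewrite mxE mulrDl. Qed.

Lemma dotpZl a u v : dotp (a *: u) v = a * dotp u v.
Proof. by rewrite /dotp mulr_sumr; apply: eq_bigr => i _; rewrite mxE mulrA. Qed.

Lemma dotpNl u v : dotp (- u) v = - dotp u v.
Proof. by rewrite -scaleN1r dotpZl mulN1r. Qed.

Lemma dotpDr u v w : dotp u (v + w) = dotp u v + dotp u w.
Proof. by rewrite ![dotp u _]dotpC dotpDl. Qed.

Lemma dotpZr a u v : dotp u (a *: v) = a * dotp u v.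
Proof. by rewrite ![dotp u _]dotpC dotpZl. Qed.

Lemma dotpNr u v : dotp u (- v) = - dotp u v.
Proof. by rewrite ![dotp u _]dotpC dotpNl. Qed.

Definition dotpE := (dotpDl, dotpDr, dotpNl, dotpNr, dotpZl, dotpZr).

Lemma dotp_ge0 u : 0 <= dotp u u.
Proof. by apply: sumr_ge0 => i _; exact: sqr_ge0. Qed.

Lemma enorm_ge0 u : 0 <= enorm u.
Proof. exact: sqrtr_ge0. Qed.

Lemma sqr_enorm u : enorm u ^+ 2 = dotp u u.
Proof. by rewrite sqr_sqrtr // dotp_ge0. Qed.

Lemma dotp_le0_eq0 u : dotp u u <= 0 -> u = 0.
Proof.
move=> uu_le0; apply/rowP => i; apply/eqP; rewrite mxE -sqrf_eq0.
rewrite eq_le sqr_ge0 andbT (le_trans _ uu_le0) //.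
by rewrite /dotp (bigD1 i) //= lerDl sumr_ge0 // => j _; exact: sqr_ge0.
Qed.

Lemma coord_le_enorm u i : `|u 0 i| <= enorm u.
Proof.
rewrite -(@ler_pXn2r _ 2) ?nnegrE ?enorm_ge0 // sqr_enorm real_normK ?num_real //.
by rewrite /dotp (bigD1 i) //= lerDl sumr_ge0 // => j _; exact: sqr_ge0.
Qed.

(** The nonnegative quantity [dotp (g - a *: e) (g - a *: e)] already contains
    the instance of the Cauchy-Schwarz inequality that is used here. *)
Lemma enorm_le_of_coercive a (e g : 'rV[R]_n) :
  0 < a -> a * dotp e e <= dotp g e -> a * enorm e <= enorm g.
Proof.
move=> a_gt0 coer; rewrite -(@ler_pXn2r _ 2) ?nnegrE ?enorm_ge0 //; last first.
  by rewrite mulr_ge0 ?enorm_ge0 ?ltW.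
rewrite exprMn !sqr_enorm.
have := dotp_ge0 (g - a *: e); rewrite !dotpE [dotp e g]dotpC.
have : a * (a * dotp e e) <= a * dotp g e by rewrite ler_pM2l.
nra.
Qed.

Lemma continuous_dotp_shift z :
  continuous (fun x : 'rV[R]_n => dotp (x - z) (x - z)).
Proof.
apply: continuous_big => [|i _ x]; first exact: add_continuous.
have c : {for x, continuous (fun y : 'rV[R]_n => (y - z) 0 i)}.
  have -> : (fun y : 'rV[R]_n => (y - z) 0 i) = fun y => y 0 i - z 0 i.
    by apply/funext => y; rewrite !mxE.
  by apply: continuousB; [exact: coord_continuous|exact: cst_continuous].
exact: continuousM.
Qed.

End InnerProduct.

(** * The proximal point and its residual *)

Section Prox.
Variables (R : realType) (n : nat) (f : 'rV[R]_n -> R) (mu L lam : R).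
Hypotheses (mu_gt0 : 0 < mu) (mu_le_L : mu <= L) (lam_gt0 : 0 < lam).
Hypotheses (f_diff : forall x : 'rV[R]_n, differentiable f x).
Hypotheses (f_sc : strongly_convex mu f) (f_smooth : smooth L f).

Let obj z x := lam * f x + 2^-1 * enorm (x - z) ^+ 2.

(** For [u] in the sublevel set, strong convexity at [z] makes
    [lam * dotp (grad f z) (u - z)] plus half of [enorm (u - z) ^+ 2]
    nonpositive; completing the square turns this into a
    ball centred at the explicit gradient step [z - lam *: grad f z]. *)
Lemma sublevel_in_ball z u : obj z u <= obj z z ->
  enorm (u - z + lam *: grad f z) <= enorm (lam *: grad f z).
Proof.
rewrite /obj => le_obj; rewrite -(@ler_pXn2r _ 2) ?nnegrE ?enorm_ge0 //.
have zz : enorm (z - z) ^+ 2 = 0.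
  by rewrite sqr_enorm subrr -(scale0r 0) dotpZl mul0r.
have := f_sc u z; move: le_obj; rewrite zz !sqr_enorm.
move: (u - z) (grad f z) => e g le_obj sc; rewrite !dotpE [dotp e g]dotpC.
have := dotp_ge0 e.
have : lam * (mu / 2 * dotp e e) <= lam * (f u - f z - dotp g e).
  by rewrite ler_pM2l.
have : 0 <= lam * (mu / 2 * dotp e e).
  by rewrite !mulr_ge0 ?dotp_ge0 ?invr_ge0 // ltW.
lra.
Qed.

(** The ball of [sublevel_in_ball] is enclosed in a compact box, on which the
    continuous objective attains its minimum.  Outside the sublevel set of [z]
    the objective exceeds its value at [z], so the minimum is global. *)
Lemma prox_exists z : exists x, forall y, obj z x <= obj z y.
Proof.
set g := lam *: grad f z; set r := enorm g.
pose B i := `[(z - g) 0 i - r, (z - g) 0 i + r]%classic.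
pose A := [set v : 'rV[R]_n | forall i, B i (v ord0 i)].
have inA u : obj z u <= obj z z -> u \in A.
  move=> /sublevel_in_ball; rewrite -/g -/r => le_r; rewrite inE => i /=.
  have := le_trans (coord_le_enorm _ i) le_r.
  by rewrite /B /= in_itv /= ler_norml !mxE => /andP[*]; apply/andP; split; lra.
have [|||x xA xmin] := @EVT_min_rV R n (obj z) A.
- by exists z; have := inA z (lexx _); rewrite inE.
- by apply: (@rV_compact R n B) => i; exact: segment_compact.
- apply: continuous_subspaceT => x.
  apply: (@continuousD _ _ _ (fun y => lam * f y)
    (fun y => 2^-1 * enorm (y - z) ^+ 2)).
    apply: continuousM; first exact: cst_continuous.
    exact: differentiable_continuous.
  apply: continuousM; first exact: cst_continuous.
  have -> : (fun y => enorm (y - z) ^+ 2) = fun y => dotp (y - z) (y - z).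
    by apply/funext => y; rewrite sqr_enorm.
  exact: continuous_dotp_shift.
exists x => y; have [/inA/xmin //|/ltW lt_y] := leP (obj z y) (obj z z).
by apply: le_trans lt_y; apply: xmin; exact: inA.
Qed.

(** Compare the minimizer [x] with [x - t *: r], where [r] is its residual: the
    first-order decrease of the objective is [t * dotp r r], and smoothness
    bounds the second-order error by [t ^+ 2 / 2 * (1 + lam * L) * dotp r r]. *)
Lemma residual_prox z : residual f lam z (prox lam f z) = 0.
Proof.
have xmin y : obj z (prox lam f z) <= obj z y.
  rewrite /prox; case: xgetP => [x _ /(_ y) //|].
  by have [x xP] := prox_exists z => /(_ x); case.
move: (prox lam f z) xmin => x xmin; apply: dotp_le0_eq0.
set r := residual f lam z x.
have q_gt0 : 0 < 1 + lam * L.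
  by rewrite ltr_wpDr // mulr_ge0 ?ltW // (lt_le_trans mu_gt0).
(* The objective is (1 + lam * L)-smooth: this step minimizes the bound. *)
pose t := (1 + lam * L)^-1; have t_gt0 : 0 < t by rewrite invr_gt0.
have := xmin (x - t *: r); have := f_smooth (x - t *: r) x.
have -> : x - t *: r - x = - (t *: r) by rewrite addrAC subrr add0r.
have step : x - t *: r - z = (x - z) - t *: r by rewrite addrAC.
rewrite /obj step !sqr_enorm.
have rr : dotp r r = dotp (x - z) r + lam * dotp (grad f x) r.
  by rewrite {1}/r /residual !dotpE.
clearbody r.
move: (x - t *: r) => y; move: (x - z) rr => e; move: (grad f x) => g rr.
rewrite !dotpE [dotp r e]dotpC => smo min_y.
have {}smo : lam * (f y - f x + t * dotp g r) <=
    lam * (L / 2 * (t * (t * dotp r r))).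
  by rewrite ler_pM2l //; move: smo; lra.
have tD : t * (t * dotp r r) * (1 + lam * L) = t * dotp r r.
  by rewrite /t; field; rewrite gt_eqF.
rewrite -(pmulr_rle0 _ t_gt0).
move: smo min_y tD; rewrite rr; lra.
Qed.

(** Adding the strong convexity inequalities for the pairs [(u, x)] and
    [(x, u)], where [x] is the proximal point, makes the gradient strongly
    monotone; subtracting the zero residual of [x] leaves only differences. *)
Lemma error_le_residual z u :
  enorm (u - prox lam f z) <= enorm (residual f lam z u) / (1 + lam * mu).
Proof.
have a_gt0 : 0 < 1 + lam * mu by rewrite addr_gt0 ?mulr_gt0.
rewrite ler_pdivlMr // mulrC; apply: enorm_le_of_coercive => //.
have := residual_prox z; move: (prox lam f z) => x x0.
have -> : residual f lam z u = (u - x) + lam *: (grad f u - grad f x).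
  by apply/rowP => i; move/rowP/(_ i): x0; rewrite !mxE; lra.
have := f_sc u x; have := f_sc x u; rewrite -[x - u]opprB !sqr_enorm.
move: (u - x) => e; rewrite !dotpE => sc1 sc2.
have : lam * (mu * dotp e e) <= lam * (dotp (grad f u) e - dotp (grad f x) e).
  by rewrite ler_pM2l //; lra.
lra.
Qed.

End Prox.

(** * Mean-square bounds *)

Import HBNNSimple.

(** Both integrals are suprema over simple functions, and a simple function
    below [e] becomes, scaled by [a], a simple function below [g]. *)
Lemma ge0_integral_scale_le d (T : measurableType d) (R : realType)
    (P : {measure set T -> \bar R}) (e g : T -> R) (a : R) :
  0 < a -> (forall w, 0 <= e w) -> (forall w, a * e w <= g w) ->
  (a%:E * \int[P]_w (e w)%:E <= \int[P]_w (g w)%:E)%E.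
Proof.
move=> a_gt0 e_ge0 ae_le.
have g_ge0 w : 0 <= g w by apply: le_trans (ae_le w); rewrite mulr_ge0 // ltW.
rewrite !ge0_integralTE; try by move=> w; rewrite lee_fin.
rewrite -lee_pdivlMl //; apply: ge_ereal_sup => _ [h /= h_le_e <-].
rewrite lee_pdivlMl // -sintegralrM.
apply: ereal_sup_ubound; exists (scale_nnsfun h (ltW a_gt0)) => //= w.
rewrite lee_fin (le_trans _ (ae_le w)) // ler_pM2l //.
by have := h_le_e w; rewrite lee_fin.
Qed.

Lemma expectation_sqr_le d (T : measurableType d) (R : realType)
    (P : probability T R) (e g : T -> R) (a b : R) :
  0 < a -> (forall w, 0 <= e w) -> (forall w, e w <= g w / a) ->
  ('E_P[fun w => (g w ^+ 2)%R] <= b%:E)%E ->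
  ('E_P[fun w => (e w ^+ 2)%R] <= (b / a ^+ 2)%R%:E)%E.
Proof.
move=> a_gt0 e_ge0 le_ga; rewrite !unlock => Eg_le.
rewrite mulrC EFinM lee_pdivlMl ?exprn_gt0 //; apply: le_trans Eg_le.
apply: ge0_integral_scale_le => [|w|w]; rewrite ?exprn_gt0 ?sqr_ge0 //.
have ae_le : a * e w <= g w by rewrite mulrC -ler_pdivlMr.
have ae_ge0 : 0 <= a * e w by rewrite mulr_ge0 // ltW.
by rewrite -exprMn ler_pXn2r // nnegrE // (le_trans ae_ge0).
Qed.

(** * Growth of the proximal parameter *)

Section StepSizes.
Variables (R : realType) (mu alpha gamma : R).
Hypotheses (mu_gt0 : 0 < mu) (alpha_ge1 : 1 <= alpha) (gamma_gt0 : 0 < gamma).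

Lemma lambda_gt0 : 0 < lambda mu alpha gamma.
Proof.
have alpha_gt0 : 0 < alpha by apply: lt_le_trans alpha_ge1.
by rewrite /lambda /tau divr_gt0 // mulr_gt0 // !addr_gt0 ?divr_gt0.
Qed.

Lemma alpha_le_lambda : alpha <= (2 * gamma + mu) * lambda mu alpha gamma.
Proof.
have alpha_gt0 : 0 < alpha by apply: lt_le_trans alpha_ge1.
have den : gamma * (1 + tau mu alpha gamma) = gamma + gamma / alpha + mu.
  by rewrite /tau; field; rewrite !gt_eqF.
have den_gt0 : 0 < gamma + gamma / alpha + mu by rewrite !addr_gt0 ?divr_gt0.
rewrite /lambda den mulrA ler_pdivlMr // mulrC ler_pM2r // lerD2r.
by rewrite mulr_natl mulr2n lerD2l ler_pdivrMr // ler_peMr // ltW.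
Qed.

Lemma factor_inv_sqr_le gamma_hi : gamma <= gamma_hi ->
  (1 + lambda mu alpha gamma * mu) ^- 2 <=
    ((2 * gamma_hi + mu) / mu) ^+ 2 * alpha ^- 2.
Proof.
move=> gamma_le; set K := 2 * gamma_hi + mu.
move: lambda_gt0 alpha_le_lambda; move: (lambda _ _ _) => lam lam_gt0 lam_ge.
have alpha_gt0 : 0 < alpha by apply: lt_le_trans alpha_ge1.
have K_gt0 : 0 < K by rewrite addr_gt0 // mulr_gt0 // (lt_le_trans gamma_gt0).
have a_gt0 : 0 < 1 + lam * mu by rewrite addr_gt0 ?mulr_gt0.
have alpha_le : alpha <= K / mu * (1 + lam * mu).
  have -> : K / mu * (1 + lam * mu) = K / mu + K * lam.
    by field; rewrite gt_eqF.
  apply: ler_wpDl; first by rewrite divr_ge0 // ltW.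
  by apply: le_trans lam_ge _; rewrite ler_pM2r // lerD2r ler_pM2l.
rewrite ler_pdivlMr ?exprn_gt0 // mulrC ler_pdivrMr ?exprn_gt0 // -exprMn.
by rewrite ler_pXn2r // nnegrE ?(ltW alpha_gt0) // (le_trans (ltW alpha_gt0)).
Qed.

End StepSizes.

Theorem mainTheorem4 (R : realType) (d : measure_display) (T : measurableType d)
    (P : probability T R) (n : nat) (f : 'rV[R]_n -> R)
    (mu L gamma_lo gamma_hi : R)
    (mu_gt0 : 0 < mu) (mu_le_L : mu <= L)
    (f_diff : forall x : 'rV[R]_n, differentiable f x)
    (f_sc : strongly_convex mu f) (f_smooth : smooth L f)
    (gamma_lo_gt0 : 0 < gamma_lo) (gamma_lo_le_hi : gamma_lo <= gamma_hi) :
  (forall (alpha gamma : nat -> R) (c xi x : nat -> T -> 'rV[R]_n),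
    let lam k := lambda mu (alpha k) (gamma k) in
    let g k w := residual f (lam k) (c k w + xi k w) in
    admissible_steps gamma_lo gamma_hi alpha gamma ->
    (forall k, random_vector (c k)) -> (forall k, random_vector (xi k)) ->
    exact_resolvent f lam c xi x ->
    (forall (k : nat) (w : T) (u : 'rV[R]_n),
      enorm (u - x k.+1 w) <= enorm (g k w u) / (1 + lam k * mu)) /\
    (forall k (xt : T -> 'rV[R]_n) (delta : R),
      random_vector xt ->
      ('E_P[fun w => (enorm (g k w (xt w)) ^+ 2)%R] <= (delta ^+ 2)%R%:E)%E ->
      ('E_P[fun w => (enorm (xt w - x k.+1 w) ^+ 2)%R]
         <= (delta ^+ 2 / (1 + lam k * mu) ^+ 2)%R%:E)%E)) /\
  (exists2 C : R, 0 < C &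
    forall alpha gamma : nat -> R,
    admissible_steps gamma_lo gamma_hi alpha gamma ->
    forall k,
      (1 + lambda mu (alpha k) (gamma k) * mu) ^- 2 <= C * (alpha k) ^- 2) /\
  (forall D : R, exists2 C : R, 0 < C &
    forall (alpha gamma delta : nat -> R) (c xi x xt : nat -> T -> 'rV[R]_n),
    let lam k := lambda mu (alpha k) (gamma k) in
    let g k w := residual f (lam k) (c k w + xi k w) in
    admissible_steps gamma_lo gamma_hi alpha gamma ->
    (forall k, random_vector (c k)) -> (forall k, random_vector (xi k)) ->
    exact_resolvent f lam c xi x ->
    (forall k, random_vector (xt k.+1)) ->
    (forall k, `|delta k| <= D) ->
    (forall k, ('E_P[fun w => (enorm (g k w (xt k.+1 w)) ^+ 2)%R]
                  <= (delta k ^+ 2)%R%:E)%E) ->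
    forall k, ('E_P[fun w => (enorm (xt k.+1 w - x k.+1 w) ^+ 2)%R]
                 <= (C * (alpha k) ^- 2)%R%:E)%E).

Proof.
pose C0 := ((2 * gamma_hi + mu) / mu) ^+ 2.
have C0_gt0 : 0 < C0.
  rewrite exprn_gt0 // divr_gt0 // addr_gt0 // mulr_gt0 //.
  exact: lt_le_trans gamma_lo_le_hi.
have factor_le alpha gamma : admissible_steps gamma_lo gamma_hi alpha gamma ->
    forall k, [/\ 0 < lambda mu (alpha k) (gamma k),
      0 < 1 + lambda mu (alpha k) (gamma k) * mu &
      (1 + lambda mu (alpha k) (gamma k) * mu) ^- 2 <= C0 * alpha k ^- 2].
  move=> steps k; have [alpha_ge1 /andP[lo_le le_hi]] := steps k.
  have gamma_gt0 := lt_le_trans gamma_lo_gt0 lo_le.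
  have lam_gt0 := lambda_gt0 mu_gt0 alpha_ge1 gamma_gt0.
  by split; [|rewrite addr_gt0 // (mulr_gt0 lam_gt0)|exact: factor_inv_sqr_le].
have error_le alpha gamma (c xi x : nat -> T -> 'rV[R]_n) :
    admissible_steps gamma_lo gamma_hi alpha gamma ->
    exact_resolvent f (fun k => lambda mu (alpha k) (gamma k)) c xi x ->
    forall k w u, enorm (u - x k.+1 w) <=
      enorm (residual f (lambda mu (alpha k) (gamma k)) (c k w + xi k w) u)
        / (1 + lambda mu (alpha k) (gamma k) * mu).
  move=> steps res k w u; rewrite res.
  have [lam_gt0 _ _] := factor_le _ _ steps k.
  exact: (@error_le_residual R n f mu L).
split; [|split].
- move=> alpha gamma c xi x lam g steps _ _ res; split.
    by move=> k w u; exact: error_le.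
  move=> k xt delta _; have [_ a_gt0 _] := factor_le _ _ steps k.
  apply: expectation_sqr_le => // w; first exact: enorm_ge0.
  exact: error_le.
- by exists C0 => // alpha gamma /factor_le steps k; have [] := steps k.
(* Adding 1 keeps the constant positive when D is 0. *)
- move=> D; exists ((D ^+ 2 + 1) * C0).
    by rewrite mulr_gt0 // ltr_wpDl // sqr_ge0.
  move=> alpha gamma delta c xi x xt lam g steps _ _ res _ delta_le Eg_le k.
  have [_ a_gt0 a_le] := factor_le _ _ steps k.
  apply: (@le_trans _ _ (delta k ^+ 2 / (1 + lam k * mu) ^+ 2)%:E).
    apply: expectation_sqr_le (Eg_le k) => // w; first exact: enorm_ge0.
    exact: error_le.
  rewrite lee_fin -mulrA ler_pM ?sqr_ge0 ?invr_ge0 ?sqr_ge0 //.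
  rewrite -real_normK ?num_real // ler_wpDr // ler_pXn2r ?nnegrE //.
  exact: le_trans (delta_le k).
Qed.
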